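(* Let $k\in\{3,4,5,6\}$. For any odd prime $p$ in $\mathbf Z[\tau]$, the group $G^p=\langle\mathbf r_0,\mathbf r_1,\mathbf r_2,\mathbf r_3\rangle^p$, generated by the reductions modulo $p$ of the matrices $\mathbf r_0,\mathbf r_1,\mathbf r_2,\mathbf r_3$ defined in the context, is a C-group (with these four reduced matrices as distinguished generators).
   Context: Let $\tau=\frac{1+\sqrt5}{2}$ and $\mathbf Z[\tau]=\{a+b\tau\mid a,b\in\mathbf Z\}$, with norm $N(a+b\tau)=a^2+ab-b^2$. A prime of $\mathbf Z[\tau]$ is called odd if it is not an associate of $2$. For an odd prime $p$, $\mathbf F_q=\mathbf Z[\tau]/(p)$ is a finite field of odd order $q=|N(p)|$. For $k\in\{3,4,5,6\}$ put $\rho_3=1$, $\rho_4=2$, $\rho_5=\tau^2$, $\rho_6=3$, and define the matrices over $\mathbf Z[\tau]$ $$\mathbf r_0=\begin{bmatrix}-1&\tau^2&0&0\\0&1&0&0\\0&0&1&0\\0&0&0&1\end{bmatrix},\quad \mathbf r_1=\begin{bmatrix}1&0&0&0\\1&-1&1&\rho_k\\0&0&1&0\\0&0&0&1\end{bmatrix},$$ $$\mathbf r_2=\begin{bmatrix}1&0&0&0\\0&1&0&0\\0&1&-1&0\\0&0&0&1\end{bmatrix},\quad \mathbf r_3=\begin{bmatrix}1&0&0&0\\0&1&0&0\\0&0&1&0\\0&1&0&-1\end{bmatrix}.$$ $G^p$ is the subgroup of $GL(4,\mathbf F_q)$ generated by these matrices with entries reduced modulo $p$. A group $\Gamma$ generated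 by a set $S=\{s_0,\dots,s_{n-1}\}$ of $n$ involutions is called a C-group (with distinguished generating set $S$) if it satisfies the intersection condition $\langle s_i\mid i\in I\rangle\cap\langle s_j\mid j\in J\rangle=\langle s_k\mid k\in I\cap J\rangle$ for all subsets $I,J\subseteq\{0,1,\dots,n-1\}$. *)

(* Defs.v *)
From HB Require Import structures.
From mathcomp Require Import all_boot all_order all_algebra all_fingroup all_field.
From mathcomp Require Import generic_quotient ring_quotient ring zify.
From mathcomp Require Import boolp.

Set Implicit Arguments.
Unset Strict Implicit.
Unset Printing Implicit Defensive.

Import Order.TTheory GRing.Theory Num.Theory.

Local Open Scope ring_scope.
Local Open Scope quotient_scope.

(* ZTau a b stands for a + b * tau, where tau ^+ 2 = tau + 1; the embedding   *)
(* Ztau_real below identifies this ring with a subring of the reals.          *)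
Record Ztau : Type := ZTau { coef1 : int; coeft : int }.

Definition Ztau_pair (x : Ztau) : int * int := (coef1 x, coeft x).
Definition Ztau_of_pair (u : int * int) : Ztau := ZTau u.1 u.2.
Lemma Ztau_pairK : cancel Ztau_pair Ztau_of_pair. Proof. by case. Qed.

HB.instance Definition _ := Countable.copy Ztau (can_type Ztau_pairK).

Lemma Ztau_eq (x y : Ztau) : coef1 x = coef1 y -> coeft x = coeft y -> x = y.
Proof. by case: x y => [a b] [c d] /= -> ->. Qed.

Definition Ztau_add (x y : Ztau) : Ztau :=
  ZTau (coef1 x + coef1 y) (coeft x + coeft y).
Definition Ztau_opp (x : Ztau) : Ztau := ZTau (- coef1 x) (- coeft x).

Fact Ztau_addA : associative Ztau_add.
Proof. by move=> x y z; apply: Ztau_eq => /=; ring. Qed.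
Fact Ztau_addC : commutative Ztau_add.
Proof. by move=> x y; apply: Ztau_eq => /=; ring. Qed.
Fact Ztau_add0 : left_id (ZTau 0 0) Ztau_add.
Proof. by move=> x; apply: Ztau_eq => /=; ring. Qed.
Fact Ztau_addN : left_inverse (ZTau 0 0) Ztau_opp Ztau_add.
Proof. by move=> x; apply: Ztau_eq => /=; ring. Qed.

HB.instance Definition _ :=
  GRing.isZmodule.Build Ztau Ztau_addA Ztau_addC Ztau_add0 Ztau_addN.

Definition Ztau_mul (x y : Ztau) : Ztau :=
  ZTau (coef1 x * coef1 y + coeft x * coeft y)
       (coef1 x * coeft y + coeft x * coef1 y + coeft x * coeft y).

Fact Ztau_mulA : associative Ztau_mul.
Proof. by move=> x y z; apply: Ztau_eq => /=; ring. Qed.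
Fact Ztau_mulC : commutative Ztau_mul.
Proof. by move=> x y; apply: Ztau_eq => /=; ring. Qed.
Fact Ztau_mul1 : left_id (ZTau 1 0) Ztau_mul.
Proof. by move=> x; apply: Ztau_eq => /=; ring. Qed.
Fact Ztau_mulDl : left_distributive Ztau_mul +%R.
Proof. by move=> x y z; apply: Ztau_eq => /=; ring. Qed.
Fact Ztau_oner_neq0 : ZTau 1 0 != 0.
Proof. by apply/eqP => -[]. Qed.

HB.instance Definition _ := GRing.Zmodule_isComNzRing.Build Ztau
  Ztau_mulA Ztau_mulC Ztau_mul1 Ztau_mulDl Ztau_oner_neq0.

Definition tau : Ztau := ZTau 0 1.

Definition normZ (x : Ztau) : int :=
  coef1 x ^+ 2 + coef1 x * coeft x - coeft x ^+ 2.

Definition Ztau_conj (x : Ztau) : Ztau := ZTau (coef1 x + coeft x) (- coeft x).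

Lemma coef1D x y : coef1 (x + y) = coef1 x + coef1 y. Proof. by []. Qed.
Lemma coeftD x y : coeft (x + y) = coeft x + coeft y. Proof. by []. Qed.
Lemma coef1N x : coef1 (- x) = - coef1 x. Proof. by []. Qed.
Lemma coeftN x : coeft (- x) = - coeft x. Proof. by []. Qed.
Lemma coef1M x y : coef1 (x * y) = coef1 x * coef1 y + coeft x * coeft y.
Proof. by []. Qed.
Lemma coeftM x y :
  coeft (x * y) = coef1 x * coeft y + coeft x * coef1 y + coeft x * coeft y.
Proof. by []. Qed.
Definition coefZ := (coef1D, coeftD, coef1N, coeftN, coef1M, coeftM).

Lemma tau_sqr : tau ^+ 2 = tau + 1. Proof. by apply: Ztau_eq. Qed.

Lemma Ztau_natr (n : nat) : n%:R = ZTau n 0.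
Proof.
elim: n => [//|n IHn]; rewrite -natr1 IHn.
by apply: Ztau_eq => //=; rewrite -addn1.
Qed.

Lemma Ztau_intr (z : int) : z%:~R = ZTau z 0.
Proof.
case: z => n; first by rewrite -pmulrn Ztau_natr.
by rewrite NegzE mulrNz -pmulrn Ztau_natr; apply: Ztau_eq; rewrite /= ?oppr0.
Qed.

Lemma ZtauE (x : Ztau) : x = (coef1 x)%:~R + (coeft x)%:~R * tau.
Proof.
by rewrite !Ztau_intr; apply: Ztau_eq; rewrite !coefZ /=; ring.
Qed.

Lemma normZM : {morph normZ : x y / x * y}.
Proof. by move=> x y; rewrite /normZ !coefZ; ring. Qed.

Lemma mulr_conj x : x * Ztau_conj x = (normZ x)%:~R.
Proof. by rewrite Ztau_intr /normZ; apply: Ztau_eq; rewrite !coefZ /=; ring. Qed.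

Lemma normZ_eq0 x : (normZ x == 0) = (x == 0).
Proof.
apply/eqP/eqP => [Nx0 | -> //].
have E : (2 * coef1 x + coeft x) ^+ 2 = 5 * coeft x ^+ 2.
  transitivity (4 * normZ x + 5 * coeft x ^+ 2); first by rewrite /normZ; ring.
  by rewrite Nx0 mulr0 add0r.
have t0 : coeft x = 0.
  apply/eqP; apply/negP => /negP t_neq0.
  have : (`|(2 * coef1 x + coeft x)%R| ^ 2 = 5 * `|coeft x| ^ 2)%N.
    by rewrite -!abszX E abszM.
  have t_gt0 : (0 < `|coeft x|)%N by rewrite absz_gt0.
  move=> /(congr1 (logn 5)).
  rewrite lognX lognM ?expn_gt0 ?t_gt0 // lognX (@logn_prime 5 5) //.
  by move=> /(congr1 odd); rewrite oddD !mul2n !odd_double.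
apply: Ztau_eq => //; move: E; rewrite t0 addr0 expr0n mulr0 => /eqP.
by rewrite expf_eq0 /= mulf_eq0 /= => /eqP.
Qed.

Definition Ztau_unit : pred Ztau := fun x => `|normZ x| == 1.
Definition Ztau_inv (x : Ztau) : Ztau :=
  if Ztau_unit x then (normZ x)%:~R * Ztau_conj x else x.

Fact Ztau_mulVr : {in Ztau_unit, left_inverse 1 Ztau_inv *%R}.
Proof.
move=> x ux; rewrite /Ztau_inv ifT // -mulrA (mulrC _ x) mulr_conj -intrM -expr2.
by rewrite -[normZ x ^+ 2]real_normK ?num_real // (eqP ux) expr1n.
Qed.

Fact Ztau_unitPl x y : y * x = 1 -> Ztau_unit x.
Proof.
move=> /(congr1 normZ); rewrite normZM => /(congr1 absz).
rewrite abszM => /eqP; rewrite muln_eq1 => /andP[_ /eqP Nx].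
by rewrite /Ztau_unit -abszE Nx.
Qed.

Fact Ztau_inv_out : {in [predC Ztau_unit], Ztau_inv =1 id}.
Proof. by move=> x /negPf ux; rewrite /Ztau_inv -[Ztau_unit x]/(x \in Ztau_unit) ux. Qed.

HB.instance Definition _ := GRing.ComNzRing_hasMulInverse.Build Ztau
  Ztau_mulVr Ztau_unitPl Ztau_inv_out.

Section RealEmbedding.
Variable R : rcfType.

Definition golden : R := (1 + Num.sqrt 5) / 2.

Definition Ztau_real (x : Ztau) : R :=
  (coef1 x)%:~R + (coeft x)%:~R * golden.

Lemma golden_sqr : golden ^+ 2 = golden + 1.
Proof.
have s5 : Num.sqrt (5 : R) ^+ 2 = 5 by rewrite sqr_sqrtr // ler0n.
by rewrite /golden; field: s5.
Qed.

Lemma Ztau_real_zmod_morphism : zmod_morphism Ztau_real.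
Proof. by move=> x y; rewrite /Ztau_real !coefZ !(intrD, intrN); ring. Qed.

Lemma Ztau_real_monoid_morphism : monoid_morphism Ztau_real.
Proof.
split=> [|x y]; first by rewrite /Ztau_real /= mul0r addr0.
rewrite /Ztau_real !coefZ !(intrD, intrM); ring: golden_sqr.
Qed.

HB.instance Definition _ :=
  GRing.isZmodMorphism.Build Ztau R Ztau_real Ztau_real_zmod_morphism.
HB.instance Definition _ :=
  GRing.isMonoidMorphism.Build Ztau R Ztau_real Ztau_real_monoid_morphism.

Lemma Ztau_real_inj : injective Ztau_real.
Proof.
apply: raddf_inj => x x0; apply/eqP; rewrite -normZ_eq0 -(intr_eq0 R).
have -> : (normZ x)%:~R = Ztau_real ((normZ x)%:~R) by rewrite rmorph_int.
by rewrite -mulr_conj rmorphM x0 mul0r.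
Qed.

End RealEmbedding.

Definition dvd_elt (R : comUnitRingType) (d x : R) : Prop := exists c, x = c * d.

Definition prime_elt (R : comUnitRingType) (p : R) : Prop :=
  [/\ p != 0, p \isn't a GRing.unit
    & forall a b, dvd_elt p (a * b) -> dvd_elt p a \/ dvd_elt p b].

Definition associates (R : comUnitRingType) (x y : R) : Prop :=
  exists2 u, u \is a GRing.unit & x = u * y.

Definition odd_prime (p : Ztau) : Prop := prime_elt p /\ ~ associates p 2.

(* The primality proof is an argument only because the quotient by a proper   *)
(* ideal is what carries a ring structure in ring_quotient.                   *)
Definition pideal (p : Ztau) (_ : prime_elt p) : {pred Ztau} :=
  fun x => `[< dvd_elt p x >].

Section PrimeIdeal.
Variables (p : Ztau) (p_prime : prime_elt p).
Local Notation I := (pideal p_prime).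

Lemma pidealP x : reflect (dvd_elt p x) (x \in I).
Proof. exact: asboolP. Qed.

Fact pideal_idealr : idealr_closed I.
Proof.
split.
- by apply/pidealP; exists 0; rewrite mul0r.
- apply/pidealP => -[c c1]; have [_ /negP pU _] := p_prime.
  by apply: pU; apply/unitrP; exists c; rewrite [p * c]mulrC -c1.
- move=> a x y /pidealP[c ->] /pidealP[d ->]; apply/pidealP.
  by exists (a * c + d); rewrite mulrDl mulrA.
Qed.

Fact pideal_prime : prime_idealr_closed I.
Proof.
move=> x y /pidealP xy; apply/orP; have [_ _ pP] := p_prime.
case: (pP _ _ xy) => xp.
  by left; apply/pidealP.
by right; apply/pidealP.
Qed.

HB.instance Definition _ := isIdealr.Build Ztau I pideal_idealr.
HB.instance Definition _ := isPrimeIdealrClosed.Build Ztau I pideal_prime.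

Definition Fq : Type := {ideal_quot I}.

HB.instance Definition _ := GRing.ComNzRing.on Fq.
HB.instance Definition _ := Quotient.on Fq.

HB.instance Definition _ := Countable.copy Fq (can_type (@reprK _ Fq)).

Definition redp (x : Ztau) : Fq := \pi_({ideal_quot I}) x.
HB.instance Definition _ := GRing.RMorphism.copy redp (\pi_({ideal_quot I})).

Lemma redp_eq0 x : reflect (dvd_elt p x) (redp x == 0).
Proof.
have -> : (redp x == 0) = (x \in I) by rewrite /redp piE Quotient.equivE subr0.
exact: pidealP.
Qed.

Lemma redp_surj (y : Fq) : exists x, redp x = y.
Proof. by exists (repr y); rewrite /redp reprK. Qed.

Let n := `|normZ p|%N.

Let n_gt0 : (0 < n)%N.
Proof. by have [p0 _ _] := p_prime; rewrite absz_gt0 normZ_eq0. Qed.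

Let redp_n : redp n%:R = 0.
Proof.
apply/eqP/redp_eq0.
exists (((-1) ^+ (normZ p < 0)%R) * Ztau_conj p).
rewrite -mulrA (mulrC _ p) mulr_conj.
have -> : ((-1) ^+ (normZ p < 0)%R : Ztau) = ((-1) ^+ (normZ p < 0)%R : int)%:~R.
  by rewrite rmorph_sign.
by rewrite -intrM -abszEsign.
Qed.

Let residue (u : 'I_n * 'I_n) : Fq := redp (ZTau u.1 u.2).

Let residue_surj (y : Fq) : y \in codom residue.
Proof.
have [x <-] := redp_surj y.
have n0 : (n%:Z != 0) by rewrite -lt0n.
have lt_mod (a : int) : (`|(a %% n)%Z|%N < n)%N.
  by rewrite -ltz_nat gez0_abs ?modz_ge0 // ltz_pmod.
have abs_mod (a : int) : `|(a %% n)%Z|%N = (a %% n)%Z :> int.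
  by rewrite gez0_abs ?modz_ge0.
apply/codomP; exists (Ordinal (lt_mod (coef1 x)), Ordinal (lt_mod (coeft x))).
rewrite /residue /= !abs_mod.
have {1}-> : x = ZTau (coef1 x %/ n)%Z (coeft x %/ n)%Z * n%:R
                 + ZTau (coef1 x %% n)%Z (coeft x %% n)%Z.
  rewrite Ztau_natr; apply: Ztau_eq; rewrite !coefZ /=.
    by rewrite {1}(divz_eq (coef1 x) n); ring.
  by rewrite {1}(divz_eq (coeft x) n); ring.
by rewrite rmorphD rmorphM /= redp_n mulr0 add0r.
Qed.

Let Fq_enum : seq Fq := undup (codom residue).
Fact Fq_enumP : Finite.axiom Fq_enum.
Proof.
by apply: Finite.uniq_enumP => [|y]; rewrite ?undup_uniq // mem_undup residue_surj.
Qed.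

HB.instance Definition _ := isFinite.Build Fq Fq_enumP.

Definition Fq_inv (x : Fq) : Fq := odflt 0 [pick y | y * x == 1].

Fact Fq_mulVf (x : Fq) : x != 0 -> Fq_inv x * x = 1.
Proof.
move=> x0; rewrite /Fq_inv; case: pickP => [y /eqP //|no].
have inj : injective (fun y : Fq => y * x).
  move=> y z /eqP; rewrite -subr_eq0 -mulrBl => /eqP.
  move=> /(@Quotient.rquot_IdomainAxiom _ (I : prime_idealr Ztau)).
  by rewrite (negPf x0) orbF subr_eq0 => /eqP.
by have := no (invF inj 1); rewrite (f_invF inj) eqxx.
Qed.

Fact Fq_inv0 : Fq_inv 0 = 0.
Proof.
rewrite /Fq_inv; case: pickP => [y|//].
by rewrite mulr0 eq_sym oner_eq0.
Qed.

HB.instance Definition _ := GRing.ComNzRing_isField.Build Fq Fq_mulVf Fq_inv0.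

End PrimeIdeal.

Definition rho (k : nat) : Ztau :=
  match k with
  | 3 => 1
  | 4 => 2
  | 5 => tau ^+ 2
  | 6 => 3
  | _ => 0
  end.

Definition mx4 (rows : seq (seq Ztau)) : 'M[Ztau]_4 :=
  \matrix_(i, j) nth 0 (nth [::] rows i) j.

Definition r0 : 'M[Ztau]_4 :=
  mx4 [:: [:: -1; tau ^+ 2; 0; 0];
          [::  0; 1; 0; 0];
          [::  0; 0; 1; 0];
          [::  0; 0; 0; 1]].

Definition r1 (k : nat) : 'M[Ztau]_4 :=
  mx4 [:: [:: 1;  0; 0; 0];
          [:: 1; -1; 1; rho k];
          [:: 0;  0; 1; 0];
          [:: 0;  0; 0; 1]].

Definition r2 : 'M[Ztau]_4 :=
  mx4 [:: [:: 1; 0;  0; 0];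
          [:: 0; 1;  0; 0];
          [:: 0; 1; -1; 0];
          [:: 0; 0;  0; 1]].

Definition r3 : 'M[Ztau]_4 :=
  mx4 [:: [:: 1; 0; 0;  0];
          [:: 0; 1; 0;  0];
          [:: 0; 0; 1;  0];
          [:: 0; 1; 0; -1]].

Definition refl_mx (k : nat) (i : 'I_4) : 'M[Ztau]_4 :=
  nth 1%:M [:: r0; r1 k; r2; r3] i.

Lemma refl_mxK k i : refl_mx k i *m refl_mx k i = 1%:M.
Proof.
rewrite /refl_mx; case: i => [[|[|[|[|//]]]] ?] /=; apply/matrixP;
  move=> [[|[|[|[|//]]]] ?] [[|[|[|[|//]]]] ?];
  rewrite !mxE !big_ord_recl big_ord0 !mxE /=; ring.
Qed.

Lemma refl_redp_unit k (p : Ztau) (p_prime : prime_elt p) (i : 'I_4) :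
  map_mx (redp p_prime) (refl_mx k i) \is a GRing.unit.
Proof.
suff E : map_mx (redp p_prime) (refl_mx k i) *m map_mx (redp p_prime) (refl_mx k i)
         = 1%:M by have [] := mulmx1_unit E.
by rewrite -map_mxM refl_mxK map_mx1.
Qed.

Definition refl_redp (k : nat) (p : Ztau) (p_prime : prime_elt p) (i : 'I_4) :
    {'GL_4[Fq p_prime]} :=
  FinRing.unit _ (refl_redp_unit k p_prime i).

Definition Gp (k : nat) (p : Ztau) (p_prime : prime_elt p) :
    {group {'GL_4[Fq p_prime]}} :=
  <<[set refl_redp k p_prime i | i : 'I_4]>>%G.

Definition is_Cgroup (gT : finGroupType) (n : nat) (Gamma : {group gT})
    (s : 'I_n -> gT) : Prop :=
  [/\ <<[set s i | i : 'I_n]>>%g = Gamma,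
      injective s,
      forall i, #[s i]%g = 2%N
    & forall I J : {set 'I_n},
        (<<s @: I>> :&: <<s @: J>> = <<s @: (I :&: J)>>)%g].

(* Main.v *)
Require Import Defs.
From mathcomp Require Import all_boot all_order all_algebra all_fingroup all_field.
From mathcomp Require Import cyclic ring zify.

(** Write [G_J] for the subgroup generated by the [r_i] with [i] in [J], and
    [e_b] for the standard row vectors, on which matrices act from the right.
    Since [r_i] changes a row [x] by a multiple of [x_i], every element of
    [G_J] fixes [e_b] when [b] is not in [J].  So the intersection property
    follows by induction once enough pairs [(J, b)] are known such that an
    element of [G_J] fixing [e_b] lies in [G_(J \ b)]: when neither of [I] and
    [J] contains the other, one removes from one of them an index that the other
    does not have (parabolic_removable, parabolic_meet).

    Not every pair will do: for [k = 6] and [p = 3] the element [r_1 r_3 r_1]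
    fixes [e_1] without being in the group generated by [r_3].  But some index
    in the difference of [I] and [J] can always be removed so that only
    subsets of [{0,2,3}], [{0,1}], [{1,2}], [{0,1,2}] and [{1,2,3}] are met
    (removable_choice).  In particular the hyperbolic subgroup on [{0,1,3}],
    whose reduction can be a large orthogonal group, needs no analysis.

    Apart from the case [k = 6], [J = {1,2,3}], the Coxeter group on [J] is
    finite, and the right cosets of the subgroup on [J \ b] have explicit
    representatives over the golden integers.  The claim for [(J, b)] says that
    no representative [d] outside the trivial coset satisfies [e_b d = e_b]
    modulo [p].  It holds because some entry of [e_b d - e_b] always has a norm
    that is, up to sign, a power of two, hence is invertible modulo every odd
    prime.  The table of representatives and these norms are verified by
    computation (coset_checks, coset_check_removes).

    For [k = 6] the group on [{1,2,3}] is a Euclidean triangle group.  It fixes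
    a column [delta], and on the rows killed by [delta], modulo [e_0], it acts
    through the finite dihedral group on [{1,3}] (affine_agree).  An element
    fixing [e_2] therefore agrees with an element of [G_{1,3}] up to multiples
    of [e_0].  If it also lies in [G_{0,1,3}], these multiples vanish: that
    group fixes a column whose coordinate at [0] is the unit [tau ^+ 2]
    (affine_meet). *)

Set Implicit Arguments.
Unset Strict Implicit.
Unset Printing Implicit Defensive.

Import GRing.Theory Num.Theory.

Local Open Scope ring_scope.

(** * Computing with reflections on row vectors over the golden integers *)

(** Row [i] gives the linear form [c_i] for which [r_i] is the map sending a
    column [v] to [v - c_i(v) e_i] and a row [x] to [x - x_i c_i]. *)
Definition cartan (k : nat) : seq (seq Ztau) :=
  [:: [:: 2; - tau ^+ 2; 0; 0]; [:: -1; 2; -1; - rho k];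
      [:: 0; -1; 2; 0]; [:: 0; -1; 0; 2]].

Definition cartan_entry k i j : Ztau := (nth [::] (cartan k) i)`_j.

Definition reflect_row k (x : seq Ztau) (i : nat) : seq Ztau :=
  mkseq (fun j => x`_j - x`_i * cartan_entry k i j) 4.

Definition row_word k (x : seq Ztau) (w : seq nat) : seq Ztau :=
  foldl (reflect_row k) x w.

Definition unit_row (b : nat) : seq Ztau := mkseq (fun j => (j == b)%:R) 4.

Definition word_rows k (w : seq nat) : seq (seq Ztau) :=
  [seq row_word k (unit_row b) w | b <- iota 0 4].

Definition prefixes (ws : seq (seq nat)) : seq (seq nat) :=
  undup [seq take n w | w <- ws, n <- iota 0 (size w).+1].

(** By a lemma of Deodhar, if [d] is the shortest element of a right coset of a
    parabolic subgroup of a Coxeter group and [i] is a generator, then [d i] is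
    again shortest in its coset, or [d i = t d] for a generator [t] of the
    subgroup.  Testing these two alternatives certifies that [reps] meets every
    coset. *)
Definition coset_table k (I : seq nat) (b : nat) (reps : seq (seq nat)) :=
  let table := map (word_rows k) reps in
  all (fun d => all (fun i =>
    let m := word_rows k (rcons d i) in
    (m \in table) || has (fun t => m == word_rows k (t :: d)) (rem b I)) I) reps.

(** The differences that occur always have an entry whose norm is a divisor of
    64; such an entry is invertible modulo every odd prime. *)
Definition norm64 (x : Ztau) : bool := (absz (normZ x) %| 64)%N.

Definition separated k (b : nat) (w : seq nat) : bool :=
  has (fun j => norm64 ((row_word k (unit_row b) w)`_j - (unit_row b)`_j))
      (iota 0 4).

Definition coset_check k (I : seq nat) (b : nat) (reps : seq (seq nat)) :=
  [&& all (all (fun i => i < 4)%N) reps, [::] \in reps, coset_table k I b reps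
    & all (fun d => nilp d || separated k b d) reps].

Fixpoint sublists (s : seq nat) : seq (seq nat) :=
  if s is n :: s' then map (cons n) (sublists s') ++ sublists s' else [:: [::]].

Lemma filter_sublists (a : pred nat) s : filter a s \in sublists s.
Proof.
elim: s => //= n s IHs; rewrite mem_cat; case: (a n); last by rewrite IHs orbT.
by rewrite (map_f (cons n) IHs).
Qed.

(** For [b] in [J] this says that [G_J] is abelian, or that [J] is [{1,2}],
    [{0,1,2}] or [{1,2,3}] with [b = 2], or [{0,1}] or [{0,1,2}] with [b = 0].
    The hyperbolic [J = {0,1,3}] is avoided on purpose; the other cases are enough
    by removable_choice. *)
Definition removable (J : seq nat) (b : nat) : bool :=
  [|| 1 \notin J, (b == 2) && ((0 \notin J) || (3 \notin J))
    | (b == 0) && (3 \notin J)]%N.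

(** For removable [b], and outside the Euclidean case [k = 6], [J = {1,2,3}], the
    prefixes of these words are the shortest representatives of the right cosets
    of the subgroup on [J \ b] in the Coxeter group on [J]: the words are the
    branches of a breadth-first search tree.  For [J = {0,1,2}] the
    cosets correspond to the 20 vertices of a dodecahedron ([b = 0]) or the 12
    vertices of an icosahedron ([b = 2]). *)
Definition rep_words (k : nat) (J : seq nat) (b : nat) : seq (seq nat) :=
  (if 1 \notin J then [:: [:: b]] else
   if b == 0 then
     if 2 \in J then
       [:: [:: 0; 1; 2]; [:: 0; 1; 0; 2; 1; 0; 1; 2];
           [:: 0; 1; 0; 1; 2; 1; 0; 1; 2];
           [:: 0; 1; 0; 1; 2; 1; 0; 1; 0; 2; 1; 0]]
     else [:: [:: 0; 1; 0; 1]]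
   else
     if 0 \in J then [:: [:: 2; 1; 0; 1; 2]; [:: 2; 1; 0; 1; 0; 2; 1; 0; 1; 2]]
     else if 3 \in J then
       match k with
       | 3 => [:: [:: 2; 1; 3]]
       | 4 => [:: [:: 2; 1; 3; 1; 2]]
       | _ => [:: [:: 2; 1; 3; 1; 3]; [:: 2; 1; 3; 1; 2; 3; 1; 3; 1; 2]]
       end
     else [:: [:: 2; 1]])%N.

(** The excluded case is the only one in which the Coxeter group on [J] is
    infinite, so that no finite table over the golden integers exists. *)
Lemma coset_checks k J b :
    k \in [:: 3; 4; 5; 6]%N -> J \in sublists (iota 0 4) -> b \in J ->
    removable J b -> (k, J) != (6, [:: 1; 2; 3])%N ->
  coset_check k J b (prefixes (rep_words k J b)).
Proof.
move=> k_ok J_ok bJ rJb kJ.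
have checks : all (fun k => all (fun J => all (fun b =>
    if removable J b && ((k, J) != (6, [:: 1; 2; 3])%N)
    then coset_check k J b (prefixes (rep_words k J b)) else true) J)
    (sublists (iota 0 4))) [:: 3; 4; 5; 6]%N by vm_compute.
by have /allP/(_ J J_ok)/allP/(_ b bJ) := allP checks k k_ok; rewrite rJb kJ.
Qed.

(** A set avoiding 1 may lose any index that the other set does not have.  If both
    sets contain 1 and just one of them contains 2, then it may lose 2; otherwise
    one set has 0, the other has 3, and 0 may be removed. *)
Lemma removable_choice I J :
    I \in sublists (iota 0 4) -> J \in sublists (iota 0 4) ->
    ~~ all (mem J) I -> ~~ all (mem I) J ->
  has (fun b => (b \notin I) && removable J b) J
  || has (fun b => (b \notin J) && removable I b) I.
Proof.
move=> I_ok J_ok IJ JI.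
have choices : all (fun I => all (fun J => [|| all (mem J) I, all (mem I) J,
    has (fun b => (b \notin I) && removable J b) J
  | has (fun b => (b \notin J) && removable I b) I])
    (sublists (iota 0 4))) (sublists (iota 0 4)) by vm_compute.
by have /allP/(_ J J_ok) := allP choices I I_ok; rewrite (negPf IJ) (negPf JI).
Qed.

Lemma refl_mx_cartan k (i : 'I_4) :
  refl_mx k i = 1%:M - delta_mx i ord0 *m \row_j cartan_entry k i j.
Proof.
apply/matrixP => j l; rewrite /refl_mx !mxE big_ord1 !mxE eqxx andbT.
case: i j l => [[|[|[|[|//]]]] ?] [[|[|[|[|//]]]] ?] [[|[|[|[|//]]]] ?];
  rewrite /= !mxE /cartan_entry /=; ring.
Qed.

(** * Two is invertible modulo an odd prime *)

(** If the norm is even, then both coefficients are even and the norm is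
    divisible by four: two is inert. *)
Lemma normZ_neq2 x : absz (normZ x) != 2%N.
Proof.
case: x => a b; rewrite /normZ /=.
rewrite (divz_eq a 2) (divz_eq b 2).
have a2 : (a %% 2)%Z = 0 \/ (a %% 2)%Z = 1 by lia.
have b2 : (b %% 2)%Z = 0 \/ (b %% 2)%Z = 1 by lia.
move: (a %/ 2)%Z (b %/ 2)%Z => u v.
by case: a2 => ->; case: b2 => ->; nia.
Qed.

(** A prime dividing 2 has norm neither 1 nor 2 in absolute value, so its norm
    is 4 up to sign and its cofactor in 2 is a unit. *)
Lemma redp_two p (hp : odd_prime p) : redp (proj1 hp) 2 != 0.
Proof.
case: hp => p_prime not2 /=; have [_ pU _] := p_prime.
apply/negP => /redp_eq0 [c two_cp]; apply: not2.
have pN : absz (normZ p) != 1%N.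
  by apply: contra pU => /eqP pN1; rewrite unfold_in /= /Ztau_unit -abszE pN1.
have cpN : (absz (normZ c) * absz (normZ p) = 4)%N.
  by rewrite -abszM -normZM -two_cp.
have cN : absz (normZ c) = 1%N.
  move: (normZ_neq2 p) pN cpN; case: (absz (normZ p)) => [|[|[|[|[|n]]]]] //; lia.
have cU : c \is a GRing.unit by rewrite unfold_in /= /Ztau_unit -abszE cN.
by exists c^-1; rewrite ?unitrV // two_cp mulKr.
Qed.

(** * Generation and coset representatives *)

Lemma gen_mulr_ind (gT : finGroupType) (A : {set gT}) (P : gT -> Prop) :
    P 1%g ->
    (forall g a, g \in <<A>>%g -> P g -> a \in A -> P (g * a)%g) ->
  forall g, g \in <<A>>%g -> P g.
Proof.
move=> P1 PM g /gen_prodgP[n [c cA ->]]; elim: n c cA => [|n IHn] c cA.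
  by rewrite big_ord0.
rewrite big_ord_recr; apply: PM => //; last by apply: IHn => i; apply: cA.
by apply: group_prod => i _; apply: mem_gen.
Qed.

Lemma gen_coset_reps (gT : finGroupType) (A : {set gT}) (H : {group gT})
    (reps : seq gT) :
    1%g \in reps ->
    (forall d a, d \in reps -> a \in A ->
       exists2 e, e \in reps & exists2 h, h \in H & (d * a = h * e)%g) ->
  forall g, g \in <<A>>%g ->
    exists2 e, e \in reps & exists2 h, h \in H & (g = h * e)%g.
Proof.
move=> reps1 repsM; apply: gen_mulr_ind => [|g a _ [d dR [h hH ->]] aA].
  by exists 1%g => //; exists 1%g; rewrite ?group1 ?mulg1.
have [e eR [h' h'H de]] := repsM d a dR aA; exists e => //.
by exists (h * h')%g; rewrite ?groupM // -!mulgA de.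
Qed.

(** * The reduced group *)

Section Reduction.

Variables (k : nat) (F : finFieldType) (f : {rmorphism Ztau -> F}).
Variable s : 'I_4 -> {'GL_4[F]}.
Hypothesis sE : forall i, GLval (s i) = map_mx f (refl_mx k i).
Hypothesis f2 : f 2 != 0.

Implicit Types (I J : {set 'I_4}) (g h : {'GL_4[F]}).

Local Notation e_ b := (delta_mx ord0 b : 'rV[F]_4).

Definition parabolic J : {group {'GL_4[F]}} := [group of <<s @: J>>%g].
Definition row_of (x : seq Ztau) : 'rV[F]_4 := \row_j f x`_j.
Definition col_of (x : seq Ztau) : 'cV[F]_4 := \col_j f x`_j.
Definition fixes_row g (b : 'I_4) : Prop :=
  e_ b *m GLval g = e_ b.
Definition word (w : seq nat) : {'GL_4[F]} := (\prod_(i <- w) s (inord i))%g.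

Lemma s_cartan i :
  GLval (s i) = 1%:M - delta_mx i ord0 *m \row_j f (cartan_entry k i j).
Proof.
rewrite sE refl_mx_cartan map_mxB map_mx1 map_mxM map_delta_mx.
by congr (_ - _ *m _); apply/rowP => j; rewrite !mxE.
Qed.

Lemma mulmx_s (x : 'rV[F]_4) i :
  x *m GLval (s i) = x - x ord0 i *: \row_j f (cartan_entry k i j).
Proof.
rewrite s_cartan mulmxBr mulmx1 mulmxA -colE; congr (_ - _).
by apply/rowP => j; rewrite !mxE big_ord1 !mxE.
Qed.

Lemma row_of_reflect x (i : 'I_4) :
  row_of x *m GLval (s i) = row_of (reflect_row k x i).
Proof.
by rewrite mulmx_s; apply/rowP => j; rewrite !mxE nth_mkseq // rmorphB rmorphM.
Qed.

Lemma row_of_word x w :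
  all (fun i => i < 4)%N w -> row_of x *m GLval (word w) = row_of (row_word k x w).
Proof.
rewrite /word; elim: w x => [|i w IHw] x /=.
  by rewrite big_nil GL_1E mulmx1.
case/andP=> i4 w4.
by rewrite big_cons GL_MxE mulmxA row_of_reflect IHw // inordK.
Qed.

Lemma row_of_unit (b : 'I_4) : row_of (unit_row b) = e_ b.
Proof.
by apply/rowP => j; rewrite !mxE nth_mkseq // rmorph_nat eqxx.
Qed.

Lemma GL_rowP g h :
  (forall b, e_ b *m GLval g = e_ b *m GLval h) -> g = h.
Proof.
by move=> gh; apply/val_inj/row_matrixP => b; rewrite !rowE; apply: gh.
Qed.

Lemma word_eq w w' :
    all (fun i => i < 4)%N w -> all (fun i => i < 4)%N w' ->
  word_rows k w = word_rows k w' -> word w = word w'.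
Proof.
move=> w4 w'4 ww'; apply: GL_rowP => b.
rewrite -row_of_unit !row_of_word //; congr row_of.
by move/eq_in_map: ww' => /(_ (b : nat)); apply; rewrite mem_iota /=.
Qed.

Lemma s_sqr i : (s i * s i = 1)%g.
Proof.
by apply: val_inj; rewrite [val _]GL_MxE !sE -map_mxM refl_mxK map_mx1.
Qed.

Lemma s_moves_row b : ~ fixes_row (s b) b.
Proof.
rewrite /fixes_row mulmx_s => /rowP/(_ b) /eqP.
rewrite !mxE !eqxx /= mul1r subr_eq -[X in X == _]addr0 (inj_eq (addrI _)).
rewrite (_ : cartan_entry k b b = 2) 1?eq_sym ?(negPf f2) //.
by case: b => [[|[|[|[|//]]]] ?].
Qed.

Lemma fixes_rowM g h b : fixes_row g b -> fixes_row h b -> fixes_row (g * h)%g b.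
Proof. by rewrite /fixes_row GL_MxE mulmxA => -> ->. Qed.

Lemma fixes_row_cancel g h b :
  fixes_row g b -> fixes_row (g * h)%g b -> fixes_row h b.
Proof. by rewrite /fixes_row GL_MxE mulmxA => ->. Qed.

Lemma parabolic_fixes_row J b g :
  b \notin J -> g \in parabolic J -> fixes_row g b.
Proof.
move=> bJ; move: g; apply: gen_mulr_ind => [|g _ _ gb /imsetP[i iJ ->]].
  by rewrite /fixes_row GL_1E mulmx1.
apply: fixes_rowM => //; rewrite /fixes_row mulmx_s !mxE eqxx /=.
rewrite (_ : _ == b = false) ?scale0r ?subr0 //.
by apply: contraNF bJ => /eqP <-.
Qed.

Lemma parabolic_fixes_col J v g :
    (forall i, i \in J -> \sum_(j < 4) cartan_entry k i j * v`_j = 0) ->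
  g \in parabolic J -> GLval g *m col_of v = col_of v.
Proof.
move=> vJ; move: g; apply: gen_mulr_ind => [|g _ _ gv /imsetP[i iJ ->]].
  by rewrite GL_1E mul1mx.
rewrite GL_MxE -mulmxA s_cartan mulmxBl mul1mx -mulmxA.
rewrite (_ : _ *m col_of v = 0) ?mulmx0 ?subr0 //.
apply/matrixP => a b; rewrite !mxE -[RHS](rmorph0 f) -(vJ i iJ) rmorph_sum.
by apply: eq_bigr => j _; rewrite !mxE rmorphM.
Qed.

Lemma parabolicS I J : I \subset J -> parabolic I \subset parabolic J.
Proof. by move=> IJ; apply: genS (imsetS s IJ). Qed.

Lemma mem_parabolic J i : i \in J -> s i \in parabolic J.
Proof. by move=> iJ; apply: mem_gen (imset_f s iJ). Qed.

Lemma norm64_neq0 x : norm64 x -> f x != 0.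
Proof.
move=> /dvdnP[c c64]; apply: contra_neq f2 => fx0.
have : f (normZ x)%:~R = 0 by rewrite -mulr_conj rmorphM fx0 mul0r.
rewrite rmorph_int => N0.
have : (2 ^ 6)%:R = 0 :> F.
  rewrite (_ : 2 ^ 6 = 64)%N // c64 natrM.
  by rewrite [X in _ * X]pmulrn abszE normrEsign intrM N0 mulr0 mulr0.
by move/eqP; rewrite natrX expf_eq0 /= rmorph_nat => /eqP.
Qed.

(** * Removing one generator *)

Definition index_list J : seq nat := [seq i <- iota 0 4 | inord i \in J].

Lemma mem_index_list J (i : 'I_4) : ((i : nat) \in index_list J) = (i \in J).
Proof. by rewrite mem_filter mem_iota add0n ltn_ord inord_val /= andbT. Qed.

Lemma index_list_lt J : all (fun i => i < 4)%N (index_list J).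
Proof. by apply/allP => i; rewrite mem_filter mem_iota => /andP[]. Qed.

(** Write [g = h d] with [h] in the smaller subgroup and [d] a representative.
    Both [g] and [h] fix [e_b], hence so does [d], and separation forces [d] to
    be trivial. *)
Lemma coset_check_removes J (b : 'I_4) reps :
    coset_check k (index_list J) b reps ->
  forall g, g \in parabolic J -> fixes_row g b -> g \in parabolic (J :\ b).
Proof.
move=> /and4P[reps4 reps1 /allP tab /allP sep] g gJ gb.
pose words := map (word : seq nat -> {'GL_4[F]}) reps.
have words1 : 1%g \in words.
  by apply/mapP; exists [::] => //; rewrite /word big_nil.
have wordsM d a : d \in words -> a \in s @: J -> exists2 e, e \in words &
    exists2 h, h \in parabolic (J :\ b) & (d * a = h * e)%g.
  move=> /mapP[w wR ->] /imsetP[i iJ ->].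
  have w4 := allP reps4 w wR.
  have wi : (word w * s i)%g = word (rcons w i).
    by rewrite /word -cats1 big_cat big_seq1 inord_val.
  have wi4 : all (fun i => i < 4)%N (rcons w i) by rewrite all_rcons ltn_ord.
  move/allP: (tab w wR) => /(_ i); rewrite mem_index_list => /(_ iJ) /orP[].
    case/mapP=> w' w'R ww'; exists (word w'); first exact: map_f.
    by exists 1%g; rewrite ?group1 // mul1g wi (word_eq wi4 (allP reps4 w' w'R) ww').
  case/hasP=> t; rewrite mem_rem_uniq ?filter_uniq ?iota_uniq //.
  case/andP=> /= tb tJ /eqP wt; have t4 := allP (index_list_lt J) t tJ.
  exists (word w); first exact: map_f.
  exists (s (inord t)); last first.
    by rewrite wi (word_eq wi4 _ wt) /= ?t4 // /word big_cons.
  apply: mem_parabolic; rewrite !inE -mem_index_list inordK // tJ andbT.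
  by rewrite -val_eqE /= inordK.
have [_ /mapP[w wR ->] [h hP gw]] := gen_coset_reps words1 wordsM gJ.
have [w0 | w_neq0] := boolP (nilp w).
  by rewrite gw (nilP w0) /word big_nil mulg1.
have hb : fixes_row h b.
  by apply: (@parabolic_fixes_row (J :\ b)) => //; rewrite setD11.
have w_b : fixes_row (word w) b by rewrite gw in gb; apply: fixes_row_cancel gb.
have := sep w wR; rewrite (negPf w_neq0) => /hasP[j].
rewrite mem_iota => j4 /norm64_neq0/eqP[]; rewrite rmorphB.
move: w_b; rewrite /fixes_row -row_of_unit row_of_word ?(allP reps4) //.
by move/rowP/(_ (Ordinal j4)); rewrite !mxE => ->; rewrite subrr.
Qed.

(** * The Euclidean triangle group *)

Lemma row_of_diff v v' : size v = 4%N -> size v' = 4%N -> behead v = behead v' ->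
  row_of v - row_of v' = f (v`_0 - v'`_0) *: e_ (inord 0).
Proof.
case: v v' => [|c v] [|c' v'] //= _ _ ->.
apply/rowP => j; rewrite !mxE eqxx /= -val_eqE /= inordK // rmorphB.
by case: j => [[|j] ?] /=; rewrite ?mulr1 ?mulr0 ?subrr.
Qed.

(** The rows killed by [delta = (0,2,1,1)] form an invariant subspace containing
    the fixed row [e_0].  On the quotient by [e_0] the generator [r_2] acts as
    the reflection in the highest short root [2 e_1 + e_3] of the root system of
    type G2, which is also the word [r_1 r_3 r_1 r_3 r_1]; so replacing each
    [r_2] by this word turns [g] into the required [h]. *)
Lemma affine_agree g : k = 6%N ->
    g \in parabolic [set i | val i \in [:: 1; 2; 3]%N] ->
  exists2 h, h \in parabolic [set i | val i \in [:: 1; 3]%N] &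
    forall x : 'rV[F]_4, x *m col_of [:: 0; 2; 1; 1] = 0 ->
    exists a, x *m GLval g - x *m GLval h = a *: e_ (inord 0).
Proof.
move=> k6; set delta := col_of _; set W := word [:: 1; 3; 1; 3; 1]%N.
have r2_word (x : 'rV[F]_4) : x *m delta = 0 ->
    exists a, x *m GLval (s (inord 2)) - x *m GLval W = a *: e_ (inord 0).
  move=> x_delta; pose c j := x ord0 (inord j).
  have xc j : x ord0 j = c j by rewrite /c inord_val.
  (* A basis of the rows killed by [delta]. *)
  have -> : x = c 0%N *: row_of (unit_row 0) + c 1%N *: row_of [:: 0; 1; -2; 0]
                + c 3%N *: row_of [:: 0; 0; -1; 1].
    have c2 : c 2%N = - (2 * c 1%N + c 3%N).
      move/matrixP/(_ ord0 ord0): x_delta; rewrite !mxE !big_ord_recl big_ord0.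
      rewrite !mxE !xc /= !(rmorph0, rmorph1) (rmorph_nat f 2) => e.
      by apply/eqP; rewrite -subr_eq0 -e; apply/eqP; ring.
    apply/rowP => j; rewrite !mxE xc.
    case: j => [[|[|[|[|//]]]] ?] /=;
      rewrite ?c2 !(rmorphN, rmorph0, rmorph1) ?(rmorph_nat f 2); ring.
  have -> : s (inord 2) = word [:: 2%N] by rewrite /word big_seq1.
  rewrite !mulmxDl -!scalemxAl !row_of_word // k6.
  have comb (a1 a2 a3 : F) (u1 u2 u3 v1 v2 v3 : 'rV[F]_4) :
      (a1 *: u1 + a2 *: u2 + a3 *: u3) - (a1 *: v1 + a2 *: v2 + a3 *: v3)
      = a1 *: (u1 - v1) + a2 *: (u2 - v2) + a3 *: (u3 - v3).
    by apply/rowP => j; rewrite !mxE; ring.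
  rewrite comb !row_of_diff //.
  by rewrite !scalerA -!scalerDl; eexists.
have fixes0 J h : inord 0 \notin J -> h \in parabolic J -> forall a : F,
    (a *: e_ (inord 0)) *m GLval h = a *: e_ (inord 0).
  by move=> J0 hJ a; rewrite -scalemxAl (parabolic_fixes_row J0 hJ).
have fixes_delta h : h \in parabolic [set i | val i \in [:: 1; 2; 3]%N] ->
    GLval h *m delta = delta.
  apply: parabolic_fixes_col => i; rewrite inE k6.
  by case: i => [[|[|[|[|//]]]] ?] //= _; rewrite !big_ord_recl big_ord0;
     apply: Ztau_eq.
have no0 (I : seq nat) : 0%N \notin I -> inord 0 \notin [set i : 'I_4 | val i \in I].
  by rewrite inE /= inordK.
move: g; apply: gen_mulr_ind => [|g a gP [h hP gh] /imsetP[i iJ ->]].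
  by exists 1%g => // x _; exists 0; rewrite subrr scale0r.
have [i2 | i_neq2] := eqVneq i (inord 2); last first.
  exists (h * s i)%g.
    rewrite groupM // mem_parabolic //; move: iJ i_neq2.
    by rewrite !inE -val_eqE /= inordK //; case: (i : nat) => [|[|[|[|]]]].
  move=> x /gh[b xb]; exists b; rewrite !GL_MxE !mulmxA -mulmxBl xb.
  exact: (fixes0 _ _ (no0 _ _) (mem_parabolic iJ)).
have WP : W \in parabolic [set i | val i \in [:: 1; 3]%N].
  rewrite /W /word big_seq; apply: group_prod => j jW; apply: mem_parabolic.
  by move: jW; case: j => [|[|[|[|j]]]] //= _; rewrite inE /= inordK.
exists (h * W)%g; first by rewrite groupM.
move=> x x_delta; have [b xb] := gh x x_delta.
have [|c xc] := r2_word (x *m GLval g); first by rewrite -mulmxA fixes_delta.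
exists (c + b); rewrite !GL_MxE !mulmxA i2 scalerDl -xc.
rewrite -(fixes0 _ _ (no0 _ _) WP b) // -xb mulmxBl.
by rewrite addrA subrK.
Qed.

(** Fixing [e_2] alone would not suffice: for [p = 3] the Euclidean group contains
    elements that fix [e_2] outside the dihedral group.  The column [y] below is
    orthogonal to [c_0], [c_1] and [c_3], hence fixed by the second subgroup, and
    detects the multiples of [e_0] by which [g] and [h] may differ. *)
Lemma affine_meet g : k = 6%N ->
    g \in parabolic [set i | val i \in [:: 1; 2; 3]%N] ->
    g \in parabolic [set~ inord 2] ->
  g \in parabolic [set i | val i \in [:: 1; 3]%N].
Proof.
move=> k6 gE g_no2; have [h hP gh] := affine_agree k6 gE.
pose y := [:: tau ^+ 2; 2; - tau; 1].
have fixes_y J h' : inord 2 \notin J -> h' \in parabolic J ->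
    GLval h' *m col_of y = col_of y.
  move=> J2; apply: parabolic_fixes_col => i iJ; rewrite k6.
  have : i != inord 2 by apply: contraNneq J2 => <-.
  rewrite -val_eqE /= inordK //; case: i {iJ} => [[|[|[|[|//]]]] ?] //= _;
    by rewrite !big_ord_recl big_ord0; apply: Ztau_eq.
have h_no2 : inord 2 \notin [set i : 'I_4 | val i \in [:: 1; 3]%N].
  by rewrite inE /= inordK.
have g_no2' : inord 2 \notin [set~ inord 2 : 'I_4] by rewrite !inE eqxx.
have eq_gh (x : 'rV[F]_4) : x *m col_of [:: 0; 2; 1; 1] = 0 ->
    x *m GLval g = x *m GLval h.
  move=> /gh[a xa]; apply/eqP; rewrite -subr_eq0 xa.
  have : a *: (e_ (inord 0) *m col_of y) = 0.
    rewrite scalemxAl -xa mulmxBl -!mulmxA (fixes_y _ _ g_no2' g_no2).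
    by rewrite (fixes_y _ _ h_no2 hP) subrr.
  move/matrixP/(_ ord0 ord0); rewrite -rowE !mxE inordK //= => /eqP.
  rewrite mulf_eq0 => /orP[/eqP->|]; first by rewrite scale0r.
  suff : f (tau ^+ 2) \is a GRing.unit by rewrite unitfE => /negPf->.
  by apply: rmorph_unit; apply: rpredX.
have row2 : e_ (inord 2) *m GLval g = e_ (inord 2) *m GLval h.
  by rewrite (parabolic_fixes_row g_no2' g_no2) (parabolic_fixes_row h_no2 hP).
have delta_row b : e_ b *m col_of [:: 0; 2; 1; 1] = (f [:: 0; 2; 1; 1]`_b)%:M.
  by apply/matrixP => a c; rewrite -rowE !mxE !ord1 eqxx.
suff -> : g = h by [].
apply: GL_rowP => b.
(* The rows killed by [delta] and [e_2] span, as [delta] has coordinate 1 at 2. *)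
pose m := [:: 0; 2; 1; 1]`_b : Ztau.
have -> : e_ b = (e_ b - f m *: e_ (inord 2)) + f m *: e_ (inord 2).
  by rewrite subrK.
rewrite [LHS]mulmxDl [RHS]mulmxDl -!scalemxAl row2 eq_gh //.
rewrite mulmxBl -scalemxAl !delta_row inordK //= scale_scalar_mx.
by rewrite rmorph1 mulr1 subrr.
Qed.

(** * The intersection property *)

Lemma index_listE J : J = [set i | val i \in index_list J].
Proof. by apply/setP => i; rewrite inE mem_index_list. Qed.

Lemma index_list_sublists J : index_list J \in sublists (iota 0 4).
Proof. exact: filter_sublists. Qed.

Lemma parabolic_removable J (b : 'I_4) g : k \in [:: 3; 4; 5; 6]%N ->
    b \in J -> removable (index_list J) b ->
    g \in parabolic J -> g \in parabolic [set~ b] ->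
  g \in parabolic (J :\ b).
Proof.
move=> k_ok bJ rJb gJ g_b.
have [[k6 J6] | not_affine] := eqVneq (k, index_list J) (6, [:: 1; 2; 3])%N.
  have b2 : b = inord 2.
    apply: val_inj; rewrite /= inordK //.
    by move: rJb; rewrite J6; case: (b : nat) => [|[|[|]]].
  suff -> : J :\ b = [set i | val i \in [:: 1; 3]%N].
    apply: affine_meet => //; last by rewrite -b2.
    by rewrite -J6 -index_listE.
  apply/setP => i; rewrite !inE -mem_index_list J6 b2 -val_eqE /= inordK // !inE.
  by case: (i : nat) => [|[|[|[|]]]].
apply: (coset_check_removes (coset_checks k_ok _ _ rJb not_affine)) => //.
- exact: index_list_sublists.
- by rewrite mem_index_list.
- by apply: parabolic_fixes_row g_b; rewrite !inE eqxx.
Qed.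

(** Induction on the sizes of [I] and [J].  If [b] is removable from [J] and is
    not in [I], an element of the intersection lies in the subgroup on the
    complement of [b], hence in the one on [J \ b], and [I :&: J] is unchanged. *)
Lemma parabolic_meet I J : k \in [:: 3; 4; 5; 6]%N ->
  parabolic I :&: parabolic J = parabolic (I :&: J) :> {set _}.
Proof.
move=> k_ok; apply/eqP; rewrite eqEsubset subsetI.
rewrite !parabolicS ?subsetIl ?subsetIr // !andbT.
have [n] := ubnP (#|I| + #|J|); elim: n I J => // n IHn I J.
have nested A B : all (mem (index_list B)) (index_list A) -> A \subset B.
  move=> /allP AB; apply/subsetP => i; rewrite -!mem_index_list; exact: AB.
have [/nested IJ _ | nIJ] := boolP (all (mem (index_list J)) (index_list I)).
  by rewrite (setIidPl IJ) subsetIl.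
have [/nested JI _ | nJI] := boolP (all (mem (index_list I)) (index_list J)).
  by rewrite (setIidPr JI) subsetIr.
have step (A B : {set 'I_4}) (b : nat) : (#|A| + #|B| < n.+1)%N ->
    b \in index_list B -> b \notin index_list A -> removable (index_list B) b ->
    parabolic A :&: parabolic B \subset parabolic (A :&: B).
  move=> ltABn bB bA rb; have b4 := allP (index_list_lt B) b bB.
  pose c := Ordinal b4; have cB : c \in B by rewrite -mem_index_list.
  have cA : c \notin A by rewrite -mem_index_list.
  apply/subsetP => g /setIP[gA gB].
  have gBc : g \in parabolic (B :\ c).
    apply: parabolic_removable => //; apply: (subsetP (parabolicS _)) gA.
    by apply/subsetP => i iA; rewrite !inE; apply: contraNneq cA => <-.
  have ltABc : (#|A| + #|B :\ c| < n)%N.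
    by move: ltABn; rewrite (cardsD1 c B) cB add1n addnS ltnS.
  have /subsetP/(_ g) := IHn A (B :\ c) ltABc.
  rewrite inE gA gBc => /(_ isT); apply: (subsetP (parabolicS _)).
  by apply: setIS; apply: subsetDl.
move=> ltIJn; have := removable_choice (index_list_sublists I)
  (index_list_sublists J) nIJ nJI.
case/orP=> /hasP[b bX /andP[bY rb]]; first exact: step bX bY rb.
by rewrite setIC [I :&: J]setIC; apply: step bX bY rb; rewrite addnC.
Qed.

Lemma s_inj : injective s.
Proof.
move=> i j sij; apply/eqP; apply/negPn/negP => ij.
apply: (@s_moves_row i); rewrite sij.
apply: (@parabolic_fixes_row [set j]); first by rewrite inE.
by apply: mem_parabolic; rewrite inE.
Qed.

Lemma order_s i : #[s i]%g = 2%N.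
Proof.
apply/prime_nt_dvdP => //; last by rewrite order_dvdn expgS expg1 s_sqr.
rewrite order_eq1; apply/eqP => si1; apply: (@s_moves_row i).
by rewrite si1 /fixes_row GL_1E mulmx1.
Qed.

End Reduction.

Local Close Scope ring_scope.

Theorem theorem4p2 (k : nat) (hk : k \in [:: 3; 4; 5; 6])
    (p : Ztau) (hp : odd_prime p) :
  is_Cgroup (Gp k (proj1 hp)) (refl_redp k (proj1 hp)).
Proof.
have sE i : GLval (refl_redp k (proj1 hp) i) = map_mx (redp (proj1 hp)) (refl_mx k i).
  by [].
split=> //.
- exact: (s_inj sE (redp_two hp)).
- exact: (order_s sE (redp_two hp)).
- by move=> I J; exact: (parabolic_meet sE (redp_two hp)).
Qed.
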